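(* For all integers $d,n$ with $n-d\geq 4$, \[ \Delta_u(d,n) \leq 2(n-d)\,T_{n-d}. \] Consequently, uniformly in $d$, as $n-d\to\infty$, \[ \Delta_u(d,n) \leq (n-d)^{\frac12\log_2(n-d)+\frac32+O\left(\frac{1}{\ln(n-d)}\right)}, \] where the constant implicit in $O(\cdot)$ is absolute (independent of $d$ and $n$).
   Context: For real $\sigma>0$, $T_\sigma=\sum_{L\ge 0}\sigma^L 2^{-L(L-1)/2}$, the sum being over all integers $L\geq 0$. A polyhedron is a finite intersection of closed half-spaces; it is pointed if it has at least one vertex. The graph of a pointed polyhedron has its vertices as nodes, two of them being adjacent if they are the endpoints of a (bounded) edge of the polyhedron. The diameter of a pointed polyhedron is the diameter of this graph. $\Delta_u(d,n)$ denotes the maximum diameter of a pointed $d$-dimensional polyhedron (bounded or unbounded) with $n$ facets; it is considered for those pairs $(d,n)$ for which such polyhedra exist (for $d\ge2$, all $n\ge d$). *)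

(* Defs.v *)
From HB Require Import structures.
From mathcomp Require Export all_boot all_order all_algebra.
From mathcomp Require Export all_classical all_reals all_analysis.
Export Order.TTheory GRing.Theory Num.Theory numFieldNormedType.Exports.

Set Implicit Arguments.
Unset Strict Implicit.
Unset Printing Implicit Defensive.

Local Open Scope classical_set_scope.
Local Open Scope card_scope.
Local Open Scope ring_scope.

Section Polyhedra.
Variables (R : realType) (m : nat).
Implicit Types (P F S : set 'rV[R]_m) (u v x : 'rV[R]_m).

Definition dot (c x : 'rV[R]_m) : R := (c *m x^T) 0 0.

Definition halfspace (h : 'rV[R]_m * R) : set 'rV[R]_m :=
  [set x | dot h.1 x <= h.2].

Definition polyhedron P : Prop :=
  exists s : seq ('rV[R]_m * R),
    (forall h, h \in s -> h.1 != 0) /\ P = \bigcap_(h in [set` s]) halfspace h.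

(* For x0 in S, the affine hull of S is x0 + V, where V is the least linear
   subspace such that S is contained in x0 + V. The empty set has no
   dimension here. *)
Definition has_dim S (k : nat) : Prop :=
  exists (x0 : 'rV[R]_m) (V : {vspace 'rV[R]_m}),
    [/\ S x0,
        forall x, S x -> x - x0 \in V,
        forall W : {vspace 'rV[R]_m},
          (forall x, S x -> x - x0 \in W) -> (V <= W)%VS
      & \dim V = k].

(* The case c = 0 makes P itself (and the empty set) a face. *)
Definition face P F : Prop :=
  exists (c : 'rV[R]_m) (b : R),
    P `<=` [set x | dot c x <= b] /\ F = P `&` [set x | dot c x = b].

Definition facet P F : Prop :=
  face P F /\ exists k, has_dim P k.+1 /\ has_dim F k.

Definition vertex P x : Prop := face P [set x].

Definition pointed P : Prop := exists x, vertex P x.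

Definition segment u v : set 'rV[R]_m :=
  [set (1 - t) *: u + t *: v | t in [set t : R | 0 <= t <= 1]].

(* A bounded edge is a 1-dimensional face that is a segment with distinct
   endpoints; unbounded edges do not contribute to the graph. *)
Definition adjacent P u v : Prop :=
  [/\ vertex P u, vertex P v, u != v & face P (segment u v)].

Definition walk P u v (p : seq 'rV[R]_m) : Prop :=
  path (fun x y => `[< adjacent P x y >]) u p /\ last u p = v.

(* +oo when u and v are not connected. *)
Definition dist P u v : \bar R :=
  ereal_inf [set (size p)%:R%:E | p in walk P u v].

Definition diameter P : \bar R :=
  ereal_sup [set dist P u v | u in vertex P & v in vertex P].

End Polyhedra.

(* The ambient space R^m is not required to have dimension d. The supremum is
   taken in the extended reals; as diameters take values in nat or +oo, a finite
   supremum of a nonempty family is a maximum. It is -oo when there is no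
   pointed d-polyhedron with n facets. *)
Definition Delta_u (R : realType) (d n : nat) : \bar R :=
  ereal_sup [set D | exists (m : nat) (P : set 'rV[R]_m),
    [/\ polyhedron P, pointed P, has_dim P d, [set F | facet P F] #= `I_n
      & D = diameter P]].

Definition T (R : realType) (sigma : R) : R :=
  limn (series (fun L : nat => sigma ^+ L * 2 ^- ((L * (L - 1)) %/ 2))).

Definition log2 (R : realType) (x : R) : R := ln x / ln 2.

(* Main.v *)
Require Import Defs.
From mathcomp Require Import fintype finset ring lra zify.

Local Open Scope ring_scope.
Set Implicit Arguments.
Unset Strict Implicit.
Unset Printing Implicit Defensive.

(** The proof is a Kalai-Kleitman recursion in which only the excess s = n - d
    is tracked. Let F(s) bound the distance of two vertices u, v in any
    d-polyhedron with at most d + s facets, whatever d is.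

    If u and v lie on a common facet, that facet is a (d-1)-polyhedron with at
    most (d-1) + s facets, so the excess has not grown. Otherwise the facets at
    u and those at v are disjoint, each vertex lies on at least d facets, and
    therefore d <= s. In that case let the ball around u grow, and likewise
    around v, until its vertices touch more than half of the facets; as long as
    they touch at most half, the polyhedron Q cut out by the touched facets
    alone has at most (d + s)/2 <= d + s/2 facets, and walks in Q from u that
    are shorter than the radius are walks in P, so that the radius is at most
    F(s/2). Hence, unless v is already reached, after F(s/2) + 1 steps from u
    and from v both balls meet a common facet, where the argument goes on in
    dimension d - 1. At most s dimensions cost anything,
    and each costs 2 (F(s/2) + 1), so F(s) <= 2 s (F(s/2) + 1). Since
    T_s = 1 + s T_(s/2), the function 2 s T_s satisfies this recursion.

    Everything is carried out for systems of inequalities (possibly redundant)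
    in a fixed ambient space, of which some are imposed as equations: passing
    to a face adds an equation, passing to Q drops inequalities. Ranks enter
    only through the common kernels of sets of constraints. The recursion is
    system_diameter_bound; it rests on ball_half, hence on vtx_connected (the
    simplex method) and subsystem_edge. The lemma irredundant_presentation
    links systems to polyhedra: the essential inequalities of a minimal system
    define distinct facets.

    For the asymptotic form, phi(x) = x^(log2(x)/2 + 1/2) satisfies
    phi(x) = x phi(x/2), so that T_x / phi(x) = 1/phi(x) + T_(x/2) / phi(x/2)
    stays bounded (T_envelope). A constant factor A in front of
    s^(log2(s)/2 + 3/2) is s^(ln A / ln s). *)

(** * Linear forms and their kernels *)

Section Dot.
Variables (R : realType) (m : nat).
Implicit Types (c x y : 'rV[R]_m).

Lemma dotDr c x y : dot c (x + y) = dot c x + dot c y.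
Proof. by rewrite /dot linearD /= mulmxDr mxE. Qed.

Lemma dotZr c t x : dot c (t *: x) = t * dot c x.
Proof. by rewrite /dot linearZ /= -scalemxAr mxE. Qed.

Lemma dotNr c x : dot c (- x) = - dot c x.
Proof. by rewrite -scaleN1r dotZr mulN1r. Qed.

Lemma dotBr c x y : dot c (x - y) = dot c x - dot c y.
Proof. by rewrite dotDr dotNr. Qed.

Lemma dot0r c : dot c 0 = 0.
Proof. by rewrite -(scale0r c) dotZr mul0r. Qed.

Lemma dot_suml (I : Type) (r : seq I) (P : pred I) (a : I -> 'rV[R]_m) x :
  dot (\sum_(i <- r | P i) a i) x = \sum_(i <- r | P i) dot (a i) x.
Proof. by rewrite /dot mulmx_suml summxE. Qed.

Definition dotker c : {vspace 'rV[R]_m} :=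
  lker (linfun (mulmxr c^T : 'rV[R]_m -> 'rV[R]_1)).

Lemma mem_dotker c x : (x \in dotker c) = (dot c x == 0).
Proof.
have E : x *m c^T = (dot c x)%:M.
  by rewrite [LHS]mx11_scalar -[x *m _]trmxK trmx_mul trmxK mxE.
rewrite memv_ker lfunE /= E.
by apply/eqP/eqP => [/matrixP/(_ 0 0)|->]; rewrite ?mxE ?raddf0.
Qed.

(** The form c maps U onto a line at most, and to 0 when it vanishes on U. *)
Lemma dim_cap_dotker (U : {vspace 'rV[R]_m}) c :
  (\dim U <= \dim (U :&: dotker c) + ~~ (U <= dotker c)%VS)%N.
Proof.
have [sU|_] := boolP (U <= dotker c)%VS; first by rewrite (capv_idPl sU) addn0.
rewrite -(limg_ker_dim (linfun (mulmxr c^T : 'rV[R]_m -> 'rV[R]_1)) U) leq_add2l.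
by rewrite (leq_trans (dimvS (subvf _))) // dimvf dim_matrix.
Qed.

Lemma dim_cap_dotker_lt (U : {vspace 'rV[R]_m}) c :
  ~~ (U <= dotker c)%VS -> (\dim (U :&: dotker c) < \dim U)%N.
Proof.
move=> nU; rewrite (ltn_leqif (dimv_leqif_sup (capvSl U _))).
by apply: contra nU => /subv_trans; apply; exact: capvSr.
Qed.

Lemma dim1_collinear (U : {vspace 'rV[R]_m}) x y :
  (\dim U <= 1)%N -> x \in U -> y \in U -> y != 0 -> exists t, x = t *: y.
Proof.
move=> dU xU yU y0; apply/vlineP.
suff -> : <[y]>%VS = U by [].
by apply/eqP; rewrite eqEdim -memvE yU dim_vline y0.
Qed.

Lemma dim2_dotker (U : {vspace 'rV[R]_m}) c :
  (1 < \dim U)%N -> exists w, [/\ w \in U, w != 0 & dot c w = 0].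
Proof.
move=> dU; set W := (U :&: dotker c)%VS.
have dW : \dim W != 0%N.
  have := leq_trans dU (dim_cap_dotker U c).
  by rewrite /W; case: (~~ _); lia.
exists (vpick W); rewrite vpick0 -dimv_eq0 dW.
have := memv_pick W; rewrite memv_cap mem_dotker => /andP[-> /eqP ->].
by [].
Qed.

End Dot.

(** * Ratio tests *)

Section MinRatio.
Variables (R : realType) (I : finType).
Implicit Types (S : {set I}) (slack rate : I -> R).

(** The ratio test of the simplex method: moving at the given rates, the
    largest step that keeps all slacks nonnegative uses up one of them. *)
Lemma min_ratio S slack rate i0 :
  (forall i, i \in S -> 0 <= slack i) -> i0 \in S -> 0 < rate i0 ->
  exists t i, [/\ 0 <= t, i \in S, 0 < rate i, t * rate i = slack i
    & forall j, j \in S -> t * rate j <= slack j].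
Proof.
move=> s0 i0S r0.
pose P := [pred i | (i \in S) && (0 < rate i)].
have Pi0 : P i0 by rewrite /= i0S r0.
case: (arg_minP (fun i => slack i / rate i) Pi0) => i /andP[iS ri] imin.
have t0 : 0 <= slack i / rate i by rewrite divr_ge0 ?s0 // ltW.
exists (slack i / rate i), i; split => //.
  by rewrite divfK // gt_eqF.
move=> j jS; have [rj|rj] := ltP 0 (rate j).
  by rewrite -ler_pdivlMr // imin //= jS rj.
by apply: le_trans (s0 _ jS); rewrite mulr_ge0_le0.
Qed.

Lemma small_step S slack rate :
  (forall i, i \in S -> 0 < slack i) ->
  exists2 t, 0 < t & forall i, i \in S -> t * `|rate i| <= slack i.
Proof.
move=> s0.
have [i0 /andP[i0S r0]|none] := pickP [pred i | (i \in S) && (0 < `|rate i|)].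
  have [t [i [t0 iS ri ti tj]]] := @min_ratio S slack (fun i => `|rate i|) i0
    (fun i iS => ltW (s0 i iS)) i0S r0.
  exists t => //; rewrite lt_def t0 andbT; apply/eqP => t00.
  by move: ti (s0 _ iS); rewrite t00 mul0r => <-; rewrite ltxx.
exists 1 => // i iS; rewrite mul1r.
move: (none i); rewrite /= iS /= normr_gt0 => /negbFE/eqP ->.
by rewrite normr0 ltW ?s0.
Qed.

End MinRatio.

(** * Walks of bounded length *)

Section Within.
Variables (T : eqType).
Implicit Types (e : rel T) (x y z : T) (k l : nat).

Definition within e k x y : Prop :=
  exists p, [/\ path e x p, last x p = y & (size p <= k)%N].

Lemma within0 e k x : within e k x x.
Proof. by exists [::]. Qed.

Lemma within1 e x y : e x y -> within e 1 x y.
Proof. by move=> exy; exists [:: y]; rewrite /= exy. Qed.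

Lemma within_leq e k l x y : (k <= l)%N -> within e k x y -> within e l x y.
Proof. by move=> kl [p [? ? /leq_trans]]; exists p; split; auto. Qed.

Lemma within_trans e k l x y z :
  within e k x y -> within e l y z -> within e (k + l) x z.
Proof.
move=> [p [pp <- kp]] [q [qp <- lq]]; exists (p ++ q).
by rewrite cat_path pp qp last_cat size_cat leq_add.
Qed.

Lemma within_sym e k x y : symmetric e -> within e k x y -> within e k y x.
Proof.
move=> es [p [pp <- kp]]; exists (rev (belast x p)); split.
- by rewrite rev_path (eq_path (e' := e)) // => u v; rewrite es.
- by case: p {pp kp} => //= a p; rewrite rev_cons last_rcons.
- by rewrite size_rev size_belast.
Qed.

Lemma within_sub e e' k x y : subrel e e' -> within e k x y -> within e' k x y.
Proof. by move=> ee [p [pp ? ?]]; exists p; split => //; apply: sub_path pp. Qed.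

End Within.

(** * Graphs of systems of linear inequalities *)

Section System.
Variables (R : realType) (m : nat) (I : finType).
Variables (a : I -> 'rV[R]_m) (b : I -> R).
Implicit Types (J E S : {set I}) (c x y z u v w : 'rV[R]_m).

(** The dimension of this space is the corank of the constraints in S. *)
Definition kernel S : {vspace 'rV[R]_m} := (\bigcap_(i in S) dotker (a i))%VS.

Lemma kernelP S z :
  reflect (forall i, i \in S -> dot (a i) z = 0) (z \in kernel S).
Proof.
rewrite memvE; apply: (iffP subv_bigcapP) => h i iS.
  by apply/eqP; rewrite -mem_dotker memvE h.
by rewrite -memvE mem_dotker h.
Qed.

Lemma kernelS E S : E \subset S -> (kernel S <= kernel E)%VS.
Proof.
move=> /subsetP ES; apply/subvP => z /kernelP zS; apply/kernelP => i /ES.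
exact: zS.
Qed.

Lemma kernel_setU1 E i : kernel (i |: E) = (kernel E :&: dotker (a i))%VS.
Proof.
apply/vspaceP => z; rewrite memv_cap mem_dotker; apply/kernelP/andP.
  move=> h; split; last by rewrite h ?setU11.
  by apply/kernelP => j jE; rewrite h // setU1r.
by move=> [/kernelP h /eqP zi] j /setU1P[->|/h].
Qed.

(** On the affine space cut out by the equations in E, a constraint that is not
    essential is constant: it cannot define a proper face, and it is not counted
    among the inequalities. *)
Definition essential E i : bool := ~~ (kernel E <= dotker (a i))%VS.

Definition ess E J : {set I} := [set i in J | essential E i].

Lemma essential_notin E i : essential E i -> i \notin E.
Proof.
apply: contra => iE; apply/subvP => z /kernelP h.
by rewrite mem_dotker h.
Qed.

Lemma essentialS E S i : E \subset S -> essential S i -> essential E i.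
Proof. by move=> /kernelS ES; apply/contra/subv_trans. Qed.

(** Each constraint lowers the dimension by at most one, and those that are not
    essential do not lower it at all. *)
Lemma dim_kernel_setU E S :
  (\dim (kernel E) <= \dim (kernel (E :|: S)) + #|ess E S|)%N.
Proof.
have H s : (\dim (kernel E) <=
    \dim (kernel (E :|: [set:: s])) + count (essential E) s)%N.
  elim: s => [|i s IH] /=.
    rewrite addn0 dimvS // kernelS // subUset subxx.
    by apply/subsetP => i; rewrite inE.
  set F := E :|: [set:: s] in IH.
  have -> : E :|: [set:: i :: s] = i |: F.
    by apply/setP => j; rewrite !inE orbCA.
  rewrite kernel_setU1; apply: (leq_trans IH).
  rewrite addnA leq_add2r; apply: (leq_trans (dim_cap_dotker _ (a i))).
  rewrite leq_add2l; have := @essentialS E F i (subsetUl _ _).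
  by rewrite /essential; do 2!case: (~~ _) => //; move/(_ isT).
have := H (enum S); rewrite set_enum; congr (_ <= _ + _)%N.
rewrite -sum1_count big_enum_cond /= -sum1_card; apply: eq_bigl => i.
by rewrite inE.
Qed.

Lemma dim_kernel_setU1 E i : essential E i ->
  \dim (kernel E) = (\dim (kernel (i |: E))).+1.
Proof.
move=> ei; rewrite kernel_setU1.
have := dim_cap_dotker (kernel E) (a i); have := dim_cap_dotker_lt ei.
by rewrite [~~ _]ei; lia.
Qed.

(** Together with dim_kernel_setU1, this says that the excess does not grow
    when one passes to a face: i itself stops being essential. *)
Lemma card_ess_setU1 E J i : i \in J -> essential E i ->
  (#|ess (i |: E) J| < #|ess E J|)%N.
Proof.
move=> iJ ei; apply/proper_card/properP; split.
  apply/subsetP => j; rewrite !inE => /andP[-> /=].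
  exact/essentialS/subsetUr.
exists i; first by rewrite inE iJ.
by rewrite inE iJ; apply: contraL (setU11 i E); exact: essential_notin.
Qed.

Definition feas J x : Prop := forall i, i \in J -> dot (a i) x <= b i.

Definition tight J x : {set I} := [set i in J | dot (a i) x == b i].

(** Vertices of the inequalities J with the equations E, by the rank of the
    tight constraints: this compares well between systems, unlike the notion of
    a face, which depends on the whole solution set. *)
Definition vtx J E x : Prop :=
  [/\ feas J x, E \subset tight J x & kernel (tight J x) = 0%VS].

(** The common tight constraints cut out a line. *)
Definition adj J E x y : Prop :=
  [/\ vtx J E x, vtx J E y, x != y
    & (\dim (kernel (tight J x :&: tight J y)) <= 1)%N].

Definition adjb J E : rel 'rV[R]_m := fun x y => `[< adj J E x y >].

Lemma adjb_sym J E : symmetric (adjb J E).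
Proof.
by move=> x y; apply/asboolP/asboolP => -[? ? xy]; rewrite setIC; split;
  rewrite // eq_sym.
Qed.

Lemma tightP J x i : reflect (i \in J /\ dot (a i) x = b i) (i \in tight J x).
Proof. by rewrite inE; apply: (iffP andP) => -[-> /eqP]. Qed.

Lemma tight_sub J x : tight J x \subset J.
Proof. by apply/subsetP => i /tightP[]. Qed.

(** The tight constraints of a vertex determine it, so there are finitely many
    vertices. *)
Lemma vtx_inj J E x y : vtx J E x -> tight J x \subset tight J y -> x = y.
Proof.
move=> [_ _ k0] /subsetP xy; apply/eqP; rewrite -subr_eq0 -memv0 -k0.
apply/kernelP => i ix; have /tightP[_ hy] := xy _ ix.
by case/tightP: ix => _ hx; rewrite dotBr hx hy subrr.
Qed.

Lemma vtxW J E E' x : E' \subset E -> vtx J E x -> vtx J E' x.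
Proof. by move=> EE [? ? ?]; split => //; apply: subset_trans EE _. Qed.

Lemma adjbW J E E' : E' \subset E -> subrel (adjb J E) (adjb J E').
Proof.
by move=> EE x y /asboolP[vx vy xy d]; apply/asboolP; split => //; apply: vtxW EE _.
Qed.

Lemma vtx_face J E i x : vtx J E x -> i \in tight J x -> vtx J (i |: E) x.
Proof. by move=> [? Ex ?] ix; split => //; rewrite subUset sub1set ix. Qed.

(** Starting from the equations E, the constraints tight at a vertex bring the
    dimension down to 0. *)
Lemma vtx_card J E x : vtx J E x -> (\dim (kernel E) <= #|ess E (tight J x)|)%N.
Proof.
move=> [_ /setUidPr Ex k0]; have := dim_kernel_setU E (tight J x).
by rewrite Ex k0 dimv0.
Qed.

(** If y is not on an extreme ray of the pointed cone of S, some w with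
    c w = 0 is killed by all constraints tight at y. One of w, -w leaves the
    cone, so moving y along it makes a further constraint tight while c y keeps
    its value; this can be repeated only finitely often. *)
Lemma improving_extreme_ray S c y :
  kernel S = 0%VS -> (forall i, i \in S -> dot (a i) y <= 0) -> 0 < dot c y ->
  exists z, [/\ forall i, i \in S -> dot (a i) z <= 0,
    0 < dot c z,
    forall i, i \in S -> dot (a i) y = 0 -> dot (a i) z = 0
    & (\dim (kernel [set i in S | dot (a i) z == 0%R]) <= 1)%N].
Proof.
move=> kS; have [n] := ubnP #|[set i in S | dot (a i) y != 0]|.
elim: n y => // n IH y yn yS cy.
set Z := [set i in S | dot (a i) y == 0].
have [dZ|] := leqP (\dim (kernel Z)) 1; first by exists y.
move=> /(dim2_dotker c)[w [wZ w0 cw]].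
have {w wZ w0 cw} [w [wZ cw [i0 i0S iw]]] : exists w, [/\ w \in kernel Z,
    dot c w = 0 & exists2 i, i \in S & 0 < dot (a i) w].
  have [i /andP[iS iw]|none] := pickP [pred i | (i \in S) && (dot (a i) w != 0)].
    have [wi|] := ltP 0 (dot (a i) w); first by exists w; split => //; exists i.
    rewrite le_eqVlt (negPf iw) /= => wi.
    exists (- w); rewrite memvN dotNr cw oppr0; split => //; exists i => //.
    by rewrite dotNr oppr_gt0.
  case/negP: w0; rewrite -memv0 -kS; apply/kernelP => i iS.
  by move: (none i); rewrite /= iS => /negbFE/eqP.
have [t [i [t0 iS ri ti tj]]] := @min_ratio _ _ S (fun i => - dot (a i) y)
  (fun i => dot (a i) w) i0 (fun j jS => etrans (oppr_ge0 _) (yS j jS)) i0S iw.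
have Z_eq0 j : j \in S -> dot (a j) y = 0 -> dot (a j) (y + t *: w) = 0.
  move=> jS jy; move/kernelP: wZ => /(_ j).
  by rewrite inE jS jy eqxx dotDr dotZr jy => ->; rewrite // mulr0 addr0.
case: (IH (y + t *: w)) => [|||z [zS cz zy dz]].
- rewrite -ltnS; apply: leq_trans _ yn; rewrite ltnS.
  apply/proper_card/properP; split.
    apply/subsetP => j; rewrite !inE => /andP[jS]; rewrite jS /=.
    by apply: contraNN => /eqP /Z_eq0 ->.
  exists i; rewrite !inE iS /=.
    apply/negP => /eqP iy; move/kernelP: wZ => /(_ i).
    by rewrite inE iS iy eqxx => /(_ isT) wi; rewrite wi ltxx in ri.
  by rewrite dotDr dotZr ti subrr eqxx.
- by move=> j jS; rewrite dotDr dotZr -lerBrDl sub0r tj.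
- by rewrite dotDr dotZr cw mulr0 addr0.
- by exists z; split => // j jS jy; apply: zy => //; exact: Z_eq0.
Qed.

(** The ratio test along the direction z of an edge at x: the constraint that
    stops it does not vanish on z, hence completes the rank at the endpoint. *)
Lemma bounded_edge J E x z :
  vtx J E x -> z \in kernel E ->
  (forall i, i \in tight J x -> dot (a i) z <= 0) ->
  (\dim (kernel [set i in tight J x | dot (a i) z == 0%R]) <= 1)%N ->
  (exists2 i, i \in J & 0 < dot (a i) z) ->
  exists t i, [/\ 0 < t, i \in tight J (x + t *: z), 0 < dot (a i) z
    & adj J E x (x + t *: z)].
Proof.
move=> vx; have [fx Ex kx] := vx => /kernelP zE zx dz [i0 i0J i0z].
have [t [i [t0 iJ ri ti tj]]] := @min_ratio _ _ J (fun i => b i - dot (a i) x)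
  (fun i => dot (a i) z) i0 (fun j jJ => etrans (subr_ge0 _ _) (fx j jJ)) i0J i0z.
set C := [set i in tight J x | _] in dz.
have {}t0 : 0 < t.
  rewrite lt_def t0 andbT; apply: contraTneq ri => t00; rewrite -leNgt zx //.
  apply/tightP; split => //; move/eqP: ti.
  by rewrite t00 mul0r eq_sym subr_eq0 => /eqP.
have iy : i \in tight J (x + t *: z).
  by apply/tightP; split; rewrite // dotDr dotZr ti addrCA subrr addr0.
have Cy : C \subset tight J (x + t *: z).
  apply/subsetP => j; rewrite inE => /andP[/tightP[jJ jx] /eqP jz].
  by apply/tightP; rewrite dotDr dotZr jz mulr0 addr0.
have z0 : z != 0.
  by apply: contraTneq ri => ->; rewrite dot0r ltxx.
have vy : vtx J E (x + t *: z).
  split.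
  - by move=> j jJ; rewrite dotDr dotZr -lerBrDl tj.
  - apply: subset_trans Cy; apply/subsetP => j jE.
    by rewrite inE (subsetP Ex) //= zE.
  apply/eqP; rewrite -subv0; apply/subvP => w /kernelP wy.
  have wC : w \in kernel C by apply/kernelP => j /(subsetP Cy)/wy.
  have zC : z \in kernel C by apply/kernelP => j; rewrite inE => /andP[_ /eqP].
  have [r wr] := dim1_collinear dz wC zC z0.
  move: (wy _ iy); rewrite wr dotZr => /eqP; rewrite mulf_eq0 (gt_eqF ri) orbF.
  by move=> /eqP ->; rewrite scale0r mem0v.
exists t, i; split => //; split => //.
  by rewrite -subr_eq0 opprD addrA subrr sub0r oppr_eq0 scaler_eq0 gt_eqF.
apply: leq_trans dz; rewrite dimvS // kernelS // subsetI Cy andbT.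
by apply/subsetP => j; rewrite inE => /andP[].
Qed.

(** The simplex method. The sum c of the constraints tight at v has its maximum
    exactly at v. From any other vertex some edge increases c; it is bounded
    because c is, and it leads to a vertex that is closer to v in the sense that
    fewer vertices lie above it. *)
Lemma vtx_connected J E u v : vtx J E u -> vtx J E v ->
  exists k, within (adjb J E) k u v.
Proof.
move=> vu vv; have [fv /subsetP Ev kv] := vv.
pose c := \sum_(i in tight J v) a i.
have c_leif x : feas J x ->
    dot c x <= dot c v ?= iff [forall (i | i \in tight J v), dot (a i) x == b i].
  move=> fx; rewrite !dot_suml; apply: leif_sum => i /tightP[iJ ->].
  by split => //; exact: fx.
have c_lt x : vtx J E x -> x != v -> dot c x < dot c v.
  move=> vx xv; have [fx _ _] := vx; rewrite (lt_leif (c_leif x fx)).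
  apply: contra xv => /forall_inP xi; apply/eqP/esym/(vtx_inj vv).
  apply/subsetP => i iv; apply/tightP; rewrite (eqP (xi i iv)).
  by split => //; exact: (subsetP (tight_sub J v)).
pose higher x := [set S : {set I} |
  `[< exists2 w, vtx J E w & tight J w = S /\ dot c x < dot c w >]].
have [n] := ubnP #|higher u|.
elim: n u vu => // n IH u vu un.
have [<-|uv] := eqVneq u v; first by exists 0%N; exact: within0.
have cuv : 0 < dot c (v - u) by rewrite dotBr subr_gt0 c_lt.
have [fu /subsetP Eu ku] := vu.
case: (@improving_extreme_ray (tight J u) c (v - u)) => //.
  by move=> i /tightP[iJ iu]; rewrite dotBr iu subr_le0 fv.
move=> z [zu cz uz dz].
have zE : z \in kernel E.
  apply/kernelP => i iE; apply: uz (Eu _ iE) _.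
  by have [/tightP[_ iu] /tightP[_ iv]] := (Eu _ iE, Ev _ iE); rewrite dotBr iu iv subrr.
have [/exists_inP out|/exists_inPn in_cone] :=
  boolP [exists i in J, 0 < dot (a i) z].
  have [t [i [t0 _ _ auw]]] := bounded_edge vu zE zu dz out.
  set w := u + t *: z in auw; have [_ vw _ _] := auw.
  have cuw : dot c u < dot c w by rewrite dotDr dotZr ltrDl mulr_gt0.
  case: (IH w vw) => [|k wv]; last first.
    exists (1 + k)%N; apply: within_trans wv; apply/within1/asboolP.
    exact: auw.
  rewrite -ltnS; apply: leq_trans _ un; rewrite ltnS.
  apply/proper_card/properP; split.
    apply/subsetP => S; rewrite !inE => /asboolP[x vx [xS wx]].
    by apply/asboolP; exists x => //; split => //; exact: lt_trans wx.
  exists (tight J w); rewrite inE; first by apply/asboolP; exists w.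
  apply/asboolPn => -[x vx [xw wx]].
  have xwE : w = x by apply: (vtx_inj vw); rewrite xw.
  by rewrite xwE ltxx in wx.
(* The edge is a ray; at this t, the value of c would exceed its maximum. *)
pose t := (dot c v - dot c u) / dot c z + 1.
have t0 : 0 <= t.
  by rewrite addr_ge0 // divr_ge0 ?ltW // -dotBr.
have fz : feas J (u + t *: z).
  move=> i iJ; rewrite dotDr dotZr -[leRHS]addr0 lerD ?fu //.
  by rewrite mulr_ge0_le0 // leNgt in_cone.
have := (c_leif _ fz).1; rewrite dotDr dotZr mulrDl divfK ?gt_eqF // mul1r.
by rewrite addrA subrKC gerDl leNgt cz.
Qed.

(** Dropping constraints that are tight neither at x nor at any of its
    neighbours creates no new edge at x: along such an edge the constraint of J
    reached first would be tight at a neighbour, so it would belong to J'. *)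
Lemma subsystem_edge J J' E x y :
  J' \subset J -> vtx J E x -> tight J x \subset J' ->
  (forall w, adj J E x w -> tight J w \subset J') ->
  adj J' E x y -> adj J E x y.
Proof.
move=> /subsetP J'J vx xJ' nbr [[_ Ex' _] [fy' Ey' ky'] xy dxy].
have [fx Ex kx] := vx.
have tx : tight J' x = tight J x.
  apply/setP => i; apply/tightP/tightP => -[iJ xi]; split; auto.
  by apply: (subsetP xJ'); apply/tightP.
have ty : tight J' y \subset tight J y.
  by apply/subsetP => i /tightP[iJ' yi]; apply/tightP; split; auto.
have [/forall_inP fy|/forall_inPn[i0 i0J i0y]] :=
  boolP [forall i in J, dot (a i) y <= b i].
  split => //; last first.
    by apply: leq_trans dxy; rewrite dimvS // kernelS // tx setIS.
  split => //; first exact: subset_trans ty.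
  by apply/eqP; rewrite -subv0 -ky' kernelS.
pose z := y - x.
have zE : z \in kernel E.
  apply/kernelP => i iE; have /tightP[_ xi] := subsetP Ex _ iE.
  by have /tightP[_ yi] := subsetP Ey' _ iE; rewrite dotBr xi yi subrr.
have zx i : i \in tight J x -> dot (a i) z <= 0.
  move=> ix; have /tightP[_ xi] := ix; rewrite dotBr xi subr_le0 fy' //.
  exact: (subsetP xJ').
have dz : (\dim (kernel [set i in tight J x | dot (a i) z == 0%R]) <= 1)%N.
  apply: leq_trans dxy; rewrite dimvS // kernelS // -tx.
  apply/subsetP => i /setIP[ix /tightP[_ yi]]; rewrite inE ix dotBr yi.
  by case/tightP: ix => _ ->; rewrite subrr eqxx.
have i0z : 0 < dot (a i0) z.
  by rewrite dotBr subr_gt0 (le_lt_trans (fx _ i0J)) // ltNge.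
have [t [i [t0 /tightP[iJ iw] iz auw]]] :=
  bounded_edge vx zE zx dz (ex_intro2 _ _ i0 i0J i0z).
have /(subsetP (nbr _ auw)) iJ' : i \in tight J (x + t *: z) by apply/tightP.
(* The edge of J from x stops at a constraint i of J', so y is not beyond it. *)
have yz : y = x + z by rewrite addrC subrK.
clearbody z; have t1 : 1 <= t.
  have := fy' i iJ'.
  by rewrite -iw yz !dotDr dotZr lerD2l ler_pMl.
case: auw => _ [fw _ _] _ _; case/negP: i0y; apply: le_trans (fw _ i0J).
by rewrite yz !dotDr dotZr lerD2l ler_pMl.
Qed.

(** Inside the ball of radius k, the subsystem J' has no edges that J lacks; a
    walk of length less than k has no chance to leave the ball. *)
Lemma subsystem_within J J' E u k l w :
  J' \subset J -> vtx J E u ->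
  (forall x, within (adjb J E) k u x -> tight J x \subset J') -> (l < k)%N ->
  within (adjb J' E) l u w -> within (adjb J E) l u w.
Proof.
move=> J'J vu ball lk [p [pp <- pl]]; exists p; split => //.
have : forall x j, vtx J E x -> within (adjb J E) j u x -> path (adjb J' E) x p ->
   (j + size p < k)%N -> path (adjb J E) x p.
  elim: p {pp pl} => //= y p IH x j vx ux /andP[/asboolP xy yp] jk.
  have auy : adj J E x y.
    apply: subsystem_edge xy => //; first by apply/ball/within_leq/ux; lia.
    move=> z xz; apply: ball; apply: (@within_leq _ _ (j + 1)); first by lia.
    by apply: within_trans ux _; apply/within1/asboolP.
  apply/andP; split; first exact/asboolP.
  apply: (IH y j.+1) => //; last by lia.
    by case: auy.
  by rewrite -[j.+1]addn1; apply: within_trans ux _; apply/within1/asboolP.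
by move=> /(_ u 0%N vu (within0 _ _ _) pp); apply; rewrite add0n (leq_ltn_trans pl).
Qed.

Definition reached J E k u : {set I} :=
  [set i in J | `[< exists2 w, within (adjb J E) k u w & i \in tight J w >]].

Lemma within_vtx J E k u w : vtx J E u -> within (adjb J E) k u w -> vtx J E w.
Proof.
move=> vu [p [pp <- _]]; elim: p u vu pp => //= y p IH u vu /andP[/asboolP uy].
by apply: IH; case: uy.
Qed.

(** Suppose that the ball of radius G + 1 touches at most half of the essential
    constraints and that v is outside. On a shortest walk from u to v, the
    vertex w after G + 1 steps is a vertex of the subsystem of the touched
    constraints, so at most G steps lead to w there; by subsystem_within they
    also lead to w in J, and the walk was not shortest. *)
Lemma ball_half J E G u v :
  (forall J' x y, (2 * #|ess E J'| <= #|ess E J|)%N ->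
     vtx J' E x -> vtx J' E y -> within (adjb J' E) G x y) ->
  vtx J E u -> vtx J E v ->
  within (adjb J E) G.+1 u v \/ (#|ess E J| < 2 * #|ess E (reached J E G.+1 u)|)%N.
Proof.
move=> small vu vv.
have [half|] := leqP (2 * #|ess E (reached J E G.+1 u)|) #|ess E J|; last by right.
left; have [k0 uv] := vtx_connected vu vv.
have ex_k : exists k, `[< within (adjb J E) k u v >] by exists k0; apply/asboolP.
have [k /asboolP [p [pp lp sp]] kmin] := ex_minnP ex_k.
have [kG|Gk] := leqP k G.+1.
  by exists p; split => //; exact: leq_trans kG.
have sp' : size p = k.
  by apply/eqP; rewrite eqn_leq sp kmin //; apply/asboolP; exists p.
pose w := last u (take G.+1 p).
have [uw wv] : within (adjb J E) G.+1 u w /\ within (adjb J E) (k - G.+1) w v.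
  move: pp lp; rewrite -{1 2}(cat_take_drop G.+1 p) cat_path last_cat.
  move=> /andP[p1 p2] lp; split.
    by exists (take G.+1 p); rewrite size_take_min geq_minl.
  by exists (drop G.+1 p); rewrite size_drop sp'.
(* Inessential constraints, among them those of E, cost nothing and are kept. *)
pose J' := [set i in J | ~~ essential E i] :|: reached J E G.+1 u.
have J'J : J' \subset J.
  by rewrite subUset; apply/andP; split; apply/subsetP => i; rewrite inE => /andP[].
have ball x : within (adjb J E) G.+1 u x -> tight J x \subset J'.
  move=> ux; apply/subsetP => i ix; apply/setUP; right.
  by rewrite inE (subsetP (tight_sub J x) _ ix); apply/asboolP; exists x.
have ball_vtx x : within (adjb J E) G.+1 u x -> vtx J' E x.
  move=> ux; have [fx Ex kx] := within_vtx vu ux.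
  have tx : tight J' x = tight J x.
    apply/setP => i; apply/tightP/tightP => -[iJ xi]; split; auto.
      exact: (subsetP J'J).
    by apply: (subsetP (ball x ux)); apply/tightP.
  by split; rewrite ?tx // => i /(subsetP J'J); exact: fx.
have J'half : (2 * #|ess E J'| <= #|ess E J|)%N.
  apply: leq_trans half; rewrite leq_mul2l /= subset_leq_card //.
  apply/subsetP => i; rewrite !inE => /andP[/orP[/andP[_ /negPf ->]|]] //.
  by move=> ->.
have u_w := small J' u w J'half (ball_vtx u (within0 _ _ _)) (ball_vtx w uw).
have {}u_w := subsystem_within J'J vu ball (leqnn _) u_w.
have : (k <= G + (k - G.+1))%N.
  by apply/kmin/asboolP/within_trans/wv.
lia.
Qed.

(** The induction on the excess s contains an induction on the dimension d of
    the affine space, for the sharper bound with min(d, s) in place of s: the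
    steps with d > s come for free, because there u and v share a tight constraint. *)
Theorem system_diameter_bound (g : nat -> nat) :
  (forall s, (2 * s * (g s./2 + 1) <= g s)%N) ->
  forall s J E u v, (#|ess E J| <= \dim (kernel E) + s)%N ->
  vtx J E u -> vtx J E v -> within (adjb J E) (g s) u v.
Proof.
move=> gP; elim/ltn_ind => s IHs J.
suff H : forall d E u v, \dim (kernel E) = d -> (#|ess E J| <= d + s)%N ->
    vtx J E u -> vtx J E v ->
    within (adjb J E) (minn d s * (2 * (g s./2 + 1))) u v.
  move=> E u v hE vu vv; apply: within_leq (H _ E u v erefl hE vu vv).
  apply: leq_trans (gP s); rewrite mulnA [(2 * s)%N]mulnC.
  by rewrite !leq_mul2r geq_minr !orbT.
elim=> [|d IHd] E u v dE nE vu vv.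
  suff -> : u = v by exact: within0.
  apply: (vtx_inj vu); apply/subsetP => i /tightP[iJ ui]; apply/tightP.
  split => //; rewrite -ui; apply/eqP; rewrite -subr_eq0 -dotBr; apply/eqP.
  move/eqP: dE; rewrite dimv_eq0 => /eqP dE.
  suff : v - u \in kernel E.
    by rewrite dE memv0 => /eqP ->; rewrite dot0r.
  case: vu vv => _ /subsetP Eu _ [_ /subsetP Ev _].
  apply/kernelP => j jE; have /tightP[_ uj] := Eu _ jE.
  by have /tightP[_ vj] := Ev _ jE; rewrite dotBr uj vj subrr.
have shared i x y : i \in tight J x -> i \in tight J y -> essential E i ->
    vtx J E x -> vtx J E y ->
    within (adjb J E) (minn d s * (2 * (g s./2 + 1))) x y.
  move=> ix iy ei vx vy; have /tightP[iJ _] := ix.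
  apply: (within_sub (adjbW (subsetUr [set i] E))).
  apply: IHd; [| |exact: vtx_face|exact: vtx_face].
    by have := dim_kernel_setU1 ei; rewrite dE => -[].
  by have := card_ess_setU1 iJ ei; lia.
have [/exists_inP common|/exists_inPn none] :=
  boolP [exists i in tight J u :&: tight J v, essential E i].
  have [i iuv ei] := common; have [iu iv] := setIP iuv.
  apply: within_leq (shared i u v iu iv ei vu vv).
  by rewrite leq_mul2r; apply/orP; right; rewrite leq_min geq_minr andbT; lia.
have cardI (A B : {set I}) : A \subset J -> B \subset J ->
    (forall i, i \in A :&: B -> ~~ essential E i) ->
    (#|ess E A| + #|ess E B| <= #|ess E J|)%N.
  move=> /subsetP AJ /subsetP BJ AB.
  rewrite -cardsUI [X in (_ + X)%N]eq_card0 ?addn0.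
    apply/subset_leq_card/subsetP => i; rewrite !inE.
    by move=> /orP[/andP[/AJ -> ->]|/andP[/BJ -> ->]].
  move=> i; rewrite !inE; apply/negbTE/negP => /andP[/andP[iA ei] /andP[iB _]].
  by move: (AB i); rewrite inE iA iB ei => /(_ isT).
(* Without a shared constraint, u and v use up 2 (d + 1) constraints. *)
have ds : (d.+1 <= s)%N.
  have := cardI _ _ (tight_sub J u) (tight_sub J v) none.
  by have := vtx_card vu; have := vtx_card vv; rewrite dE; lia.
set G := g s./2.
have small J' x y : (2 * #|ess E J'| <= #|ess E J|)%N ->
    vtx J' E x -> vtx J' E y -> within (adjb J' E) G x y.
  by move=> half; apply: IHs; [lia | rewrite dE; lia].
have b0 : (minn d s * (2 * (G + 1)) + (G.+1 + G.+1)
    <= minn d.+1 s * (2 * (G + 1)))%N.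
  by rewrite (minn_idPl ds) (minn_idPl (ltnW ds)); lia.
have G_le := leq_trans (leq_addr G.+1 G.+1) (leq_trans (leq_addl _ _) b0).
have [uv|hu] := ball_half small vu vv.
  by exact: within_leq uv.
have [vu'|hv] := ball_half small vv vu.
  by apply: (within_sym (adjb_sym _ _)); exact: within_leq vu'.
have [/exists_inP common|/exists_inPn none'] :=
  boolP [exists i in reached J E G.+1 u :&: reached J E G.+1 v, essential E i].
  have [i iuv ei] := common; move: iuv; rewrite !inE.
  move=> /andP[/andP[iJ /asboolP[x ux ix]] /andP[_ /asboolP[y vy iy]]].
  have xy := shared i x y ix iy ei (within_vtx vu ux) (within_vtx vv vy).
  have yv := within_sym (adjb_sym _ _) vy.
  apply: within_leq (within_trans (within_trans ux xy) yv).
  by rewrite [(G.+1 + _)%N]addnC -addnA.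
have := cardI (reached J E G.+1 u) (reached J E G.+1 v) _ _ none'.
have rJ x : reached J E G.+1 x \subset J.
  by apply/subsetP => i; rewrite inE => /andP[].
by move=> /(_ (rJ _) (rJ _)); lia.
Qed.

End System.

(** * Faces and facets of the solution set of a system *)

Lemma card_le_of_inj (T : Type) (I : finType) (S : {set I}) (A : set T) n
    (f : I -> T) :
  (A #= `I_n)%card -> (forall i, i \in S -> A (f i)) ->
  {in S &, injective f} -> (#|S| <= n)%N.
Proof.
move=> An SA finj; have [->//|i0S] := posnP #|S|.
have [i0 _] := card_gt0P i0S.
rewrite -card_le_II -(card_le_eqr An).
have fS : ((f @` [set` S]) #<= A)%card.
  by apply: subset_card_le => _ [i iS <-]; exact: SA.
have finj' : {in [set` S]%classic &, injective f}.
  by move=> i j; rewrite !in_setE; exact: finj.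
have {}fS : ([set` S]%classic #<= A)%card.
  by rewrite -(card_le_eql (inj_card_eq finj')).
apply: card_le_trans fS.
apply: card_le_trans (card_image_le (index^~ (enum S)) _).
apply: subset_card_le => k /= kS; exists (nth i0 (enum S) k) => /=.
  by rewrite -mem_enum mem_nth // -cardE.
by rewrite index_uniq ?enum_uniq // -cardE.
Qed.

Section Pol.
Variables (R : realType) (m : nat) (I : finType).
Variables (a : I -> 'rV[R]_m) (b : I -> R).
Implicit Types (J E S : {set I}) (P : set 'rV[R]_m) (x y z u v w : 'rV[R]_m).
Local Notation feas := (feas a b).
Local Notation tight := (tight a b).
Local Notation vtx := (vtx a b).
Local Notation adj := (adj a b).
Local Notation kernel := (kernel a).
Local Notation essential := (essential a).
Local Notation ess := (ess a).

(** The inclusion forces E to be part of J. *)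
Definition pol J E : set 'rV[R]_m := [set x | feas J x /\ E \subset tight J x]%classic.

(** The sum of the constraints in S is maximal exactly where all are tight. *)
Lemma pol_face J S E : S \subset J -> face (pol J E) (pol J (S :|: E)).
Proof.
move=> /subsetP SJ; exists (\sum_(i in S) a i), (\sum_(i in S) b i).
have leS x : feas J x ->
    dot (\sum_(i in S) a i) x <= \sum_(i in S) b i
      ?= iff [forall (i | i \in S), dot (a i) x == b i].
  move=> fx; rewrite dot_suml; apply: leif_sum => i iS.
  by split => //; apply/fx/SJ.
split=> [x [fx _]|]; first exact: (leS x fx).1.
apply/seteqP; split => x [].
  move=> fx; rewrite subUset => /andP[/subsetP Sx Ex]; split => //=.
  apply/eqP; rewrite (leS x fx).2; apply/forall_inP => i /Sx /tightP[_ ->].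
  by rewrite eqxx.
move=> [fx Ex] /= /eqP; rewrite (leS x fx).2 => /forall_inP Sx; split => //.
rewrite subUset Ex andbT; apply/subsetP => i iS; apply/tightP.
by split; [exact: SJ | exact/eqP/Sx].
Qed.

Lemma vtx_vertex J E x : vtx J E x -> vertex (pol J E) x.
Proof.
move=> vx; rewrite /vertex; suff -> : [set x]%classic = pol J (tight J x :|: E).
  exact: pol_face (tight_sub _ _ _ _).
apply/seteqP; split => [y ->|y [fy]].
  by have [fx Ex _] := vx; split => //; rewrite subUset subxx.
by rewrite subUset => /andP[xy _]; rewrite (vtx_inj vx xy).
Qed.

(** If w is killed by all constraints tight at x, both x + t w and x - t w are
    in the polyhedron for small t; so c is constant along w, and the face that
    c defines is larger than a point unless w = 0. *)
Lemma vertex_vtx J E x : vertex (pol J E) x -> vtx J E x.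
Proof.
move=> [c [r [cP xP]]].
have [[fx Ex] cx] : (pol J E `&` [set y | dot c y = r])%classic x by rewrite -xP.
split => //; apply/eqP; rewrite -subv0; apply/subvP => w /kernelP wx.
have [i|t t0 tw] := @small_step _ _ (J :\: tight J x)
  (fun i => b i - dot (a i) x) (fun i => dot (a i) w).
  rewrite !inE => /andP[ix iJ]; rewrite subr_gt0 lt_neqAle fx // andbT.
  by move: ix; rewrite iJ.
have Px s : `|s| <= t -> pol J E (x + s *: w).
  move=> st; split.
    move=> i iJ; rewrite dotDr dotZr; have [ix|ix] := boolP (i \in tight J x).
      by rewrite wx // mulr0 addr0 fx.
    rewrite -lerBrDl; apply: le_trans (tw i _); last by rewrite inE ix.
    by apply: le_trans (ler_norm _) _; rewrite normrM ler_wpM2r.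
  apply: subset_trans Ex _; apply/subsetP => i ix; have /tightP[iJ xi] := ix.
  by apply/tightP; rewrite dotDr dotZr wx // mulr0 addr0.
have cw : dot c w = 0.
  have tt : `|t| <= t by rewrite ger0_norm // ltW.
  have := cP _ (Px t tt); have := cP _ (Px (- t) _); rewrite normrN => /(_ tt) /=.
  rewrite !dotDr !dotZr cx mulNr gerBl gerDl => cw0 cw0'.
  by apply/eqP; rewrite eq_le -(pmulr_rle0 _ t0) cw0' -(pmulr_rge0 _ t0).
have : [set x]%classic (x + t *: w).
  rewrite xP; split; last by rewrite /= dotDr dotZr cw mulr0 addr0.
  by apply: Px; rewrite ger0_norm // ltW.
move=> /= /eqP; rewrite -subr_eq0 addrAC subrr add0r scaler_eq0 gt_eqF //=.
by move=> /eqP ->; exact: mem0v.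
Qed.

(** The face of the common tight constraints lies on the line through u and v;
    constraints tight at only one of them cut it down to the segment. *)
Lemma adj_adjacent J E u v : adj J E u v -> adjacent (pol J E) u v.
Proof.
move=> [vu vv uv duv]; split => //; [exact: vtx_vertex..|].
set C := tight J u :&: tight J v in duv.
have CJ : C \subset J by rewrite (subset_trans (subsetIl _ _)) ?tight_sub.
suff -> : segment u v = pol J (C :|: E) by exact: pol_face.
have [fu Eu ku] := vu; have [fv Ev kv] := vv.
apply/seteqP; split => [_ [t /= /andP[t0 t1] <-]|y [fy]].
  split => [i iJ|].
    have -> : b i = (1 - t) * b i + t * b i by ring.
    by rewrite dotDr !dotZr lerD // ler_wpM2l ?subr_ge0 ?fu ?fv.
  apply/subsetP => i iCE.
  have /setIP[/tightP[iJ ui] /tightP[_ vi]] : i \in C.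
    by move: i iCE; apply/subsetP; rewrite subUset subxx subsetI Eu Ev.
  by apply/tightP; rewrite dotDr !dotZr ui vi -mulrDl subrK mul1r.
rewrite subUset => /andP[Cy Ey].
have common i : i \in C ->
    [/\ dot (a i) u = b i, dot (a i) v = b i & dot (a i) y = b i].
  move=> iC; have /setIP[/tightP[_ ->] /tightP[_ ->]] := iC.
  by have /tightP[_ ->] := subsetP Cy _ iC.
have [t yt] : exists t, y - u = t *: (v - u).
  apply: (dim1_collinear duv); last by rewrite subr_eq0 eq_sym.
    by apply/kernelP => i /common[iu _ iy]; rewrite dotBr iu iy subrr.
  by apply/kernelP => i /common[iu iv _]; rewrite dotBr iu iv subrr.
have yE : y = (1 - t) *: u + t *: v.
  rewrite -[y](subrK u) yt scalerBr scalerBl scale1r.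
  by rewrite -addrA [RHS]addrC [- _ + u]addrC.
(* A constraint tight at one end only bounds t on that side. *)
have side x x' s :
    vtx J E x -> feas J x' -> x != x' -> y - x = s *: (x' - x) -> 0 <= s.
  move=> vx fx' xx' ys.
  have /subsetPn[i ix ix'] : ~~ (tight J x \subset tight J x').
    by apply: contraNN xx' => /(vtx_inj vx) ->.
  have /tightP[iJ xi] := ix.
  have x'i : dot (a i) (x' - x) < 0.
    rewrite dotBr xi subr_lt0 lt_neqAle fx' // andbT.
    by move: ix'; rewrite inE iJ.
  have : dot (a i) (y - x) <= 0 by rewrite dotBr xi subr_le0 fy.
  by rewrite ys dotZr nmulr_lle0.
exists t => //=; rewrite (side _ _ _ vu fv uv yt) /= -subr_ge0.
apply: (side v u); rewrite // 1?eq_sym // yE.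
by rewrite scalerBr -addrA; congr (_ + _); rewrite scalerBl scale1r opprB.
Qed.

(** From a point where all proper inequalities are strict, one can move a little
    in every direction that the equations allow. *)
Lemma strict_dim J E z k : pol J E z ->
  (forall i, i \in J :\: E -> dot (a i) z < b i) ->
  has_dim (pol J E) k <-> k = \dim (kernel E).
Proof.
move=> Pz zstrict; have [fz /subsetP Ez] := Pz.
have dir x y : pol J E x -> pol J E y -> y - x \in kernel E.
  move=> [_ /subsetP Ex] [_ /subsetP Ey]; apply/kernelP => i iE.
  have /tightP[_ xi] := Ex _ iE; have /tightP[_ yi] := Ey _ iE.
  by rewrite dotBr xi yi subrr.
have min_dir x (W : {vspace 'rV[R]_m}) :
    (forall y, pol J E y -> y - x \in W) -> (kernel E <= W)%VS.
  move=> PW; apply/subvP => w /kernelP wE.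
  have [i iJE|t t0 tw] := @small_step _ _ (J :\: E)
    (fun i => b i - dot (a i) z) (fun i => dot (a i) w).
    by rewrite subr_gt0 zstrict.
  have /PW zw : pol J E (z + t *: w).
    have zwE i : i \in E -> dot (a i) (z + t *: w) = b i.
      move=> iE; have /tightP[_ zi] := Ez _ iE.
      by rewrite dotDr dotZr wE // mulr0 addr0.
    split => [i iJ|]; last first.
      apply/subsetP => i iE; have /tightP[iJ _] := Ez _ iE.
      by apply/tightP; split => //; exact: zwE.
    have [/zwE ->//|iE] := boolP (i \in E).
    rewrite dotDr dotZr -lerBrDl; apply: le_trans (tw i _); last by rewrite inE iE.
    by rewrite ler_wpM2l ?ler_norm // ltW.
  have -> : w = t^-1 *: ((z + t *: w - x) - (z - x)).
    by rewrite opprB addrA subrK addrAC subrr add0r scalerA mulVf ?scale1r ?gt_eqF.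
  by rewrite memvZ // memvB // PW.
split=> [[x [V [Px PV minV dV]]]|->].
  rewrite -dV; congr (\dim _); apply: subv_anti.
  rewrite (min_dir x) // andbT; apply: minV => y; exact: dir.
exists z, (kernel E); split => // [x|W]; [exact: dir|exact: min_dir].
Qed.

(** Dropping j lets in a point y beyond j; the segment from x0 to y crosses the
    hyperplane of j at a point z where the other inequalities are strict. So
    j defines a facet, and z tells this facet from all others. *)
Lemma facet_card_ess J E x0 n :
  ([set F | facet (pol J E) F]%classic #= `I_n)%card ->
  pol J E x0 -> (forall i, i \in J :\: E -> dot (a i) x0 < b i) ->
  (forall j, j \in J :\: E -> ~ (pol (J :\ j) E `<=` pol J E)%classic) ->
  (#|ess E J| <= n)%N.
Proof.
move=> facets Px0 x0s irr; have [fx0 Ex0] := Px0.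
pose F j := pol J (j |: E).
have tip j : j \in J :\: E -> essential E j /\
    exists2 z, F j z & forall i, i \in J :\: (j |: E) -> dot (a i) z < b i.
  move=> jJE; have /setDP[jJ jE] := jJE.
  have [y [fy Ey] yP] : exists2 y, pol (J :\ j) E y & ~ pol J E y.
    apply: contrapT => h; apply: (irr j jJE) => y Py.
    by apply: contrapT => yP; apply: h; exists y.
  have yj : b j < dot (a j) y.
    rewrite ltNge; apply/negP => yj; apply: yP; split.
      move=> i iJ; have [->//|ij] := eqVneq i j.
      by apply: fy; rewrite !inE ij.
    by apply: subset_trans Ey _; apply/subsetP => i; rewrite !inE => /andP[/andP[_ ->]].
  have xj := x0s _ jJE.
  have Eeq i : i \in E -> dot (a i) x0 = b i /\ dot (a i) y = b i.
    move=> iE; have /tightP[_ ->] := subsetP Ex0 _ iE.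
    by have /tightP[_ ->] := subsetP Ey _ iE.
  split.
    apply/negP => /subvP/(_ (y - x0)) kerE; suff /kerE : y - x0 \in kernel E.
      by rewrite mem_dotker dotBr subr_eq0 gt_eqF ?(lt_trans xj).
    by apply/kernelP => i /Eeq[xi yi]; rewrite dotBr xi yi subrr.
  pose t := (b j - dot (a j) x0) / (dot (a j) y - dot (a j) x0).
  have d0 : 0 < dot (a j) y - dot (a j) x0 by rewrite subr_gt0 (lt_trans xj).
  have t0 : 0 < t by rewrite divr_gt0 // subr_gt0.
  have t1 : t < 1 by rewrite ltr_pdivrMr // mul1r ltrD2r.
  pose z := x0 + t *: (y - x0).
  have zE i : dot (a i) z = (1 - t) * dot (a i) x0 + t * dot (a i) y.
    by rewrite dotDr dotZr dotBr; ring.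
  have zj : dot (a j) z = b j.
    by rewrite dotDr dotZr dotBr divfK ?gt_eqF // addrC subrK.
  have zi i : i \in J :\: (j |: E) -> dot (a i) z < b i.
    move=> /setDP[iJ]; rewrite !inE negb_or => /andP[ij iE].
    have xi : dot (a i) x0 < b i by rewrite x0s // inE iE.
    have yi : dot (a i) y <= b i by rewrite fy // !inE ij.
    rewrite zE; have := ltr_pM2l (_ : 0 < 1 - t); nra.
  have ze i : i \in E -> dot (a i) z = b i.
    by move=> /Eeq[xi yi]; rewrite zE xi yi -mulrDl subrK mul1r.
  exists z => //; split=> [i iJ|].
    have [iE|iE] := boolP (i \in j |: E); last by rewrite ltW // zi // inE iE.
    by move: iE => /setU1P[->|/ze ->//]; rewrite zj.
  apply/subsetP => i iE; apply/tightP.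
  move: iE => /setU1P[-> //|iE]; split; last exact: ze.
  exact: (subsetP (tight_sub a b J x0)) (subsetP Ex0 _ iE).
apply: (leq_trans (n := #|J :\: E|)).
  apply/subset_leq_card/subsetP => i; rewrite !inE => /andP[iJ ei].
  by rewrite iJ (essential_notin ei).
apply: (card_le_of_inj (f := F) facets) => [j jJE|j j' jJE j'JE FF].
  have [ej [z Fz zs]] := tip j jJE; split.
    by apply: pol_face; rewrite sub1set; case/setDP: jJE.
  exists (\dim (kernel (j |: E))).
  split; last exact/(strict_dim _ Fz zs).
  by apply/(strict_dim _ Px0 x0s); rewrite (dim_kernel_setU1 ej).
have [_ [z Fz zs]] := tip j jJE.
have [_ /subsetP z'] : F j' z by rewrite -FF.
apply/eqP/negPn/negP => jj'; have /setDP[j'J j'E] := j'JE.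
have /tightP[_ zj'] := z' j' (setU11 _ _).
have := zs j'; rewrite zj' ltxx !inE negb_or j'E eq_sym jj' j'J => /(_ isT).
by [].
Qed.

End Pol.

(** * Irredundant systems and the diameter of a polyhedron *)

Section Presentation.
Variables (R : realType) (m : nat).
Implicit Types (P : set 'rV[R]_m).

(** Midpoints of solutions are strict wherever one of the two is. *)
Lemma strict_point (I : finType) (a : I -> 'rV[R]_m) b J E (S : {set I}) x :
  pol a b J E x ->
  (forall i, i \in S -> exists2 y, pol a b J E y & dot (a i) y < b i) ->
  S \subset J ->
  exists2 y, pol a b J E y & forall i, i \in S -> dot (a i) y < b i.
Proof.
move=> Px strict /subsetP SJ.
have : forall s : seq I, {subset s <= S} ->
    exists2 y, pol a b J E y & forall i, i \in s -> dot (a i) y < b i.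
  elim=> [|j s IH] sS; first by exists x.
  have [y [fy Ey] ys] :
      exists2 y, pol a b J E y & forall i, i \in s -> dot (a i) y < b i.
    by apply: IH => i si; apply: sS; rewrite inE si orbT.
  have [z [fz Ez] zj] := strict j (sS j (mem_head _ _)).
  have mid i : dot (a i) (2^-1 *: (y + z)) = (dot (a i) y + dot (a i) z) / 2.
    by rewrite dotZr dotDr mulrC.
  exists (2^-1 *: (y + z)); first split.
  - by move=> i iJ; rewrite mid; have := fy i iJ; have := fz i iJ; lra.
  - apply/subsetP => i iE; have /tightP[iJ yi] := subsetP Ey _ iE.
    have /tightP[_ zi] := subsetP Ez _ iE; apply/tightP; split => //.
    by rewrite mid yi zi; lra.
  move=> i; rewrite inE mid => /predU1P[->|si].
    by have := fy j (SJ _ (sS j (mem_head _ _))); lra.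
  have := ys i si; have := fz i (SJ _ (sS i _)).
  by rewrite inE si orbT => /(_ isT); lra.
move=> /(_ (enum S))[i|y Py ys]; first by rewrite mem_enum.
by exists y => // i iS; apply: ys; rewrite mem_enum.
Qed.

(** The equations E are the inequalities that hold with equality on all of P,
    and J is minimal among the subsystems containing E that describe P. *)
Lemma irredundant_presentation P d n :
  polyhedron P -> has_dim P d -> ([set F | facet P F]%classic #= `I_n)%card ->
  exists (I : finType) (a : I -> 'rV[R]_m) b (J E : {set I}),
    [/\ P = pol a b J E, \dim (kernel a E) = d & (#|ess a E J| <= n)%N].
Proof.
move=> [s [_ PE]] dimP facets.
pose I : finType := 'I_(size s).
pose a (i : I) := (nth (0, 0) s i).1; pose b (i : I) := (nth (0, 0) s i).2.
pose E := [set i : I | `[< forall x, P x -> dot (a i) x = b i >]].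
have PT x : P x <-> feas a b [set: I] x.
  rewrite PE; split => [Px i _|fx h /= hs].
    by apply: (Px (nth (0, 0) s i)) => /=; rewrite mem_nth.
  have hs' : (index h s < size s)%N by rewrite index_mem.
  have := fx (Ordinal hs') (in_setT _).
  by rewrite /halfspace /a /b /= nth_index.
have PEq x i : P x -> i \in E -> dot (a i) x = b i.
  by move=> Px; rewrite inE => /asboolP; apply.
have PpolT : P = pol a b [set: I] E.
  apply/seteqP; split => x; last by case=> /PT.
  move=> Px; split; first exact/PT.
  by apply/subsetP => i iE; apply/tightP; split; rewrite ?in_setT // PEq.
pose describes (J : {set I}) := (E \subset J) && `[< pol a b J E = P >].
have /minset_exists[J /minsetP[/andP[EJ /asboolP PJ] Jmin] _] : describes [set: I].
  by rewrite /describes subsetT; apply/asboolP.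
have [x0 Px0] : exists x, P x by case: dimP => x [V [Px _ _ _]]; exists x.
have [y Py ys] :
    exists2 y, pol a b J E y & forall i, i \in J :\: E -> dot (a i) y < b i.
  apply: (@strict_point I a b J E (J :\: E) x0); rewrite ?PJ ?subsetDl //.
  move=> i /setDP[iJ iE]; apply: contrapT => none; move: iE; rewrite inE.
  move=> /asboolPn; apply => x Px; apply/eqP; rewrite eq_le.
  have /PT fx := Px; rewrite fx ?in_setT //= leNgt; apply/negP => xi.
  by apply: none; exists x.
exists I, a, b, J, E; split => //.
  by apply/esym/(strict_dim _ Py ys); rewrite PJ.
apply: (@facet_card_ess _ _ _ _ b J E y) => //; first by rewrite PJ.
move=> j /setDP[jJ jE] sub.
have /Jmin/(_ (subsetDl _ _)) : describes (J :\ j).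
  have EJj : E \subset J :\ j by rewrite subsetD1 EJ.
  rewrite /describes EJj; apply/asboolP; rewrite -PJ.
  apply/seteqP; split => // x [fx Ex]; split.
    by move=> i; rewrite !inE => /andP[_]; exact: fx.
  apply/subsetP => i iE; apply/tightP; split; first exact: (subsetP EJj).
  by have /tightP[] := subsetP Ex _ iE.
by move=> JE; have := setD11 j J; rewrite JE jJ.
Qed.

Lemma diameter_le P d n (g : nat -> nat) :
  (forall s, (2 * s * (g s./2 + 1) <= g s)%N) ->
  polyhedron P -> has_dim P d -> ([set F | facet P F]%classic #= `I_n)%card ->
  (diameter P <= (g (n - d)%N)%:R%:E)%E.
Proof.
move=> gP polP dimP facets.
have [I [a [b [J [E [PE dE cardJ]]]]]] := irredundant_presentation polP dimP facets.
apply: ge_ereal_sup => _ [u vu [v vv <-]].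
move: vu vv; rewrite PE => /vertex_vtx vu /vertex_vtx vv.
have [|p [up uv sp]] := system_diameter_bound gP (s := n - d) _ vu vv.
  by rewrite dE; lia.
apply: (@le_trans _ _ (size p)%:R%:E); last by rewrite lee_fin ler_nat.
apply: ereal_inf_lbound; exists p => //; split => //.
apply: sub_path up => x y /asboolP xy; apply/asboolP; exact: adj_adjacent.
Qed.

End Presentation.

Lemma Delta_u_le (R : realType) d n (g : nat -> nat) :
  (forall s, (2 * s * (g s./2 + 1) <= g s)%N) ->
  (Delta_u R d n <= (g (n - d)%N)%:R%:E)%E.
Proof.
move=> gP; apply: ge_ereal_sup => _ [k [P [polP _ dimP facets ->]]].
exact: diameter_le.
Qed.

(** * The series T *)

Section TSeries.
Local Open Scope classical_set_scope.
Local Open Scope ring_scope.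
Variable R : realType.
Implicit Types (x y : R).

Definition Tterm x (L : nat) : R := x ^+ L * 2 ^- ((L * (L - 1)) %/ 2).

(** The exponents L (L - 1) / 2 are the triangular numbers, and the
    difference L of two consecutive ones is absorbed into x / 2. *)
Lemma TtermS x L : Tterm x L.+1 = x * Tterm (x / 2) L.
Proof.
rewrite /Tterm exprS expr_div_n -!mulrA -invfM -exprD; do 2!congr (_ * _).
congr (_ ^- _); rewrite !divn2 subSS subn0 subn1.
rewrite -[(L * L.-1)./2]bin2 -[(L.+1 * L)./2]/((L.+1 * L.+1.-1)./2) -bin2.
by rewrite binS bin1 addnC.
Qed.

Lemma seriesS x n :
  series (Tterm x) n.+1 = 1 + x * series (Tterm (x / 2)) n.
Proof.
rewrite /series /= big_nat_recl // {1}/Tterm expr0 mul0n div0n expr0 invr1 mulr1.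
by rewrite mulr_sumr; congr (_ + _); apply: eq_bigr => i _; rewrite TtermS.
Qed.

Lemma Tterm_ge0 x L : 0 <= x -> 0 <= Tterm x L.
Proof. by move=> x0; rewrite mulr_ge0 // ?exprn_ge0 // invr_ge0 exprn_ge0. Qed.

(** The recursion of seriesS keeps the partial sums below 2 for x <= 1/2, and
    carries a bound at x / 2 over to x. *)
Lemma series_bounded k x : 0 <= x <= 2 ^+ k / 2 ->
  exists M, forall n, series (Tterm x) n <= M.
Proof.
elim: k x => [|k IH] x /andP[x0 xk].
  exists 2 => n; elim: n x x0 xk => [|n IH] x x0 xk.
    by rewrite /series /= big_geq.
  rewrite seriesS; rewrite expr0 in xk IH.
  have := IH (x / 2); rewrite !mulr_ge0 ?invr_ge0 // => /(_ isT); nra.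
have [|M MP] := IH (x / 2).
  by move: xk; rewrite exprS => xk; apply/andP; split; lra.
exists (1 + x * `|M|) => -[|n].
  by rewrite /series /= big_geq // addr_ge0 // mulr_ge0.
by rewrite seriesS lerD2l ler_wpM2l // (le_trans (MP n)) // ler_norm.
Qed.

Lemma T_cvg x : 0 <= x -> cvgn (series (Tterm x)).
Proof.
move=> x0; have [|M MP] := @series_bounded (Num.bound (2 * x)) x.
  by have := upper_nthrootP (leqnn (Num.bound (2 * x))); rewrite x0 /=; lra.
apply: nondecreasing_is_cvgn; last by exists M => _ [n _ <-].
by apply: nondecreasing_series => n _ _; exact: Tterm_ge0.
Qed.

(** The functional equation behind both parts of the theorem. *)
Lemma T_rec x : 0 <= x -> T x = 1 + x * T (x / 2).
Proof.
move=> x0; have x20 : 0 <= x / 2 by rewrite divr_ge0.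
have lim1 : (fun n => series (Tterm x) n.+1) @ \oo --> T x.
  by rewrite cvg_shiftS; exact: T_cvg.
have lim2 : (fun n => series (Tterm x) n.+1) @ \oo --> 1 + x * T (x / 2).
  rewrite (_ : (fun n => _) = fun n => 1 + x * series (Tterm (x / 2)) n).
    by apply: cvgD; [exact: cvg_cst|apply: cvgM; [exact: cvg_cst|exact: T_cvg]].
  by apply/funext => n; rewrite seriesS.
exact: (cvg_unique _ lim1 lim2).
Qed.

Lemma T_le x y : 0 <= x <= y -> T x <= T y.
Proof.
move=> /andP[x0 xy]; have y0 := le_trans x0 xy.
apply: ler_lim; [exact: T_cvg..|]; apply: nearW => n.
apply: ler_sum => i _; rewrite ler_wpM2r ?invr_ge0 ?exprn_ge0 //.
by rewrite lerXn2r ?nnegrE.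
Qed.

Lemma T_ge0 x : 0 <= x -> 0 <= T x.
Proof.
move=> x0; apply: limr_ge; first exact: T_cvg.
by apply: nearW => n; apply: sumr_ge0 => i _; exact: Tterm_ge0.
Qed.

(** The function 2 s T_s, rounded down, satisfies the recursion for walk
    lengths. *)
Lemma truncn_2sT_rec s :
  (2 * s * (Num.truncn (2 * s./2%:R * T (s./2%:R : R)) + 1)
    <= Num.truncn (2 * s%:R * T (s%:R : R)))%N.
Proof.
set h := s./2%:R : R; have h0 : 0 <= h := ler0n _ _.
have T0 := T_ge0 h0.
have hs : h <= s%:R / 2.
  by rewrite ler_pdivlMr // -natrM ler_nat muln2 -[leqRHS](odd_double_half s) leq_addl.
rewrite truncn_ge_nat ?mulr_ge0 ?T_ge0 // natrM natrD natrM.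
rewrite (T_rec (ler0n _ s)) ler_wpM2l ?mulr_ge0 //= addrC lerD2l.
have : (Num.truncn (2 * h * T h))%:R <= 2 * h * T h.
  by rewrite truncn_le !mulr_ge0.
move=> /le_trans; apply; apply: ler_pM; rewrite ?mulr_ge0 //; first by lra.
by apply: T_le; rewrite h0.
Qed.

End TSeries.

(** * Growth of T *)

Section Growth.
Variable R : realType.
Implicit Types (x y : R).

(** The solution of f x = x f (x / 2) that has the size of T. *)
Definition envelope x : R := x `^ (1 / 2 * log2 x + 1 / 2).

Lemma envelopeE x : 0 < x ->
  envelope x = expR (ln x * (1 / 2 * (ln x / ln 2) + 1 / 2)).
Proof. by move=> x0; rewrite /envelope /powR gt_eqF // mulrC. Qed.

Lemma ln2_pos : 0 < ln 2 :> R. Proof. by rewrite ln_gt0 // ltr1n. Qed.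

Lemma envelope_rec x : 0 < x -> envelope x = x * envelope (x / 2).
Proof.
move=> x0; have c0 := ln2_pos.
rewrite !envelopeE ?divr_gt0 // ln_div ?posrE //.
rewrite -[X in X * expR _]lnK ?posrE // -expRD.
by congr expR; field; rewrite gt_eqF.
Qed.

Lemma envelope_ge1 x : 1 <= x -> 1 <= envelope x.
Proof.
move=> x1; rewrite envelopeE ?(lt_le_trans ltr01) // -[leLHS]expR0 ler_expR.
have l0 := ln_ge0 x1; have c0 := ln2_pos.
have q0 : 0 <= ln x / ln 2 by rewrite divr_ge0 // ltW.
by rewrite mulr_ge0 //; lra.
Qed.

Lemma envelope_ge x : 2 <= x -> x <= envelope x.
Proof.
move=> x2; have x0 : 0 < x by lra.
rewrite envelopeE // -{1}[x]lnK ?posrE // ler_expR.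
have l0 : ln 2 <= ln x by rewrite ler_ln ?posrE.
have c0 := ln2_pos; have l1 : 1 <= ln x / ln 2 by rewrite ler_pdivlMr // mul1r.
by rewrite ler_peMr ?(le_trans (ltW c0)) //; lra.
Qed.

(** By the functional equations, the quotient of T by the envelope increases
    from x / 2 to x by the inverse of envelope x, which is at most 1 / x; this
    is what - 1 / x gains from x / 2 to x. *)
Lemma T_envelope x : 1 <= x -> T x <= (T 2 + 1 - x^-1) * envelope x.
Proof.
move=> x1.
have [k] : exists k, x < 2 ^+ k by exists (Num.bound x); exact: upper_nthrootP.
elim: k x x1 => [|k IH] x x1 xk; first by move: xk; rewrite expr0 ltNge x1.
have x0 : 0 < x by lra.
have ix : x^-1 <= 1 by rewrite invf_le1.
have T2 : 0 <= T (2 : R) by apply: T_ge0.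
(* Below 2 there is nothing to halve: the constant T 2 + 1 is chosen for this. *)
have [x2|x2] := ltP x 2.
  have Tx : T x <= T 2 by apply: T_le; lra.
  apply: (le_trans Tx); have := envelope_ge1 x1; nra.
have Th : T (x / 2) <= (T 2 + 1 - (x / 2)^-1) * envelope (x / 2).
  by apply: IH; [lra|move: xk; rewrite exprS; lra].
rewrite (T_rec (ltW x0)).
have e1 : 1 <= x^-1 * envelope x by rewrite mulrC ler_pdivlMr // mul1r envelope_ge.
have -> : (T 2 + 1 - x^-1) * envelope x =
    x * ((T 2 + 1 - (x / 2)^-1) * envelope (x / 2)) + x^-1 * envelope x.
  rewrite (envelope_rec x0); field; rewrite gt_eqF //.
by rewrite [leLHS]addrC; apply: lerD e1; rewrite ler_wpM2l // ltW.
Qed.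

End Growth.

(** * The diameter bound *)

Theorem theorem2 (R : realType) :
  (forall d n : nat, (4 <= n - d)%N ->
     (Delta_u R d n <= (2 * (n - d)%:R * T ((n - d)%:R : R))%:E)%E)
  /\
  (exists (e : nat -> nat -> R) (C : R) (N : nat),
     (forall d n : nat, (N <= n - d)%N ->
        `|e d n| <= C * `|1 / ln ((n - d)%:R : R)|) /\
     (forall d n : nat, (4 <= n - d)%N -> (N <= n - d)%N ->
        (Delta_u R d n <=
          ((n - d)%:R `^ (1 / 2 * log2 ((n - d)%:R : R) + 3 / 2 + e d n))%:E)%E)).
Proof.
have bound d n : (Delta_u R d n <= (2 * (n - d)%:R * T ((n - d)%:R : R))%:E)%E.
  apply: le_trans (Delta_u_le R d n (@truncn_2sT_rec R)) _.
  by rewrite lee_fin truncn_le !mulr_ge0 ?T_ge0.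
split=> [d n _|]; first exact: bound.
pose K : R := T 2 + 1; have K1 : 1 <= K by rewrite lerDr T_ge0.
(* With this exponent, s to the power e d n is the constant 2 K. *)
exists (fun d n => ln (2 * K) * (1 / ln ((n - d)%:R : R))), (ln (2 * K)), 4%N.
split=> [d n _|d n nd _].
  by rewrite normrM (ger0_norm (ln_ge0 _)) //; lra.
apply: le_trans (bound d n) _; rewrite lee_fin.
set s := (n - d)%:R : R.
have s4 : 4 <= s by rewrite ler_nat.
have s0 : 0 < s by lra.
have s1 : 1 < s by lra.
have -> : 1 / 2 * log2 s + 3 / 2 + ln (2 * K) * (1 / ln s) =
  1 + (1 / 2 * log2 s + 1 / 2) + ln (2 * K) / ln s by lra.
have powD r t : s `^ (r + t) = s `^ r * s `^ t.
  by rewrite powRD // (gt_eqF s0) implybT.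
rewrite powD (powD 1) (powRr1 (ltW s0)).
have -> : s `^ (ln (2 * K) / ln s) = 2 * K.
  by rewrite /powR gt_eqF // divfK ?gt_eqF ?ln_gt0 // lnK // posrE; lra.
have := T_envelope (ltW s1); rewrite -/K -/(envelope s) => Ts.
have e1 := envelope_ge1 (ltW s1); have i0 : 0 <= s^-1 by rewrite invr_ge0 ltW.
have {}Ts : T s <= K * envelope s.
  by apply: le_trans Ts _; rewrite ler_wpM2r ?(le_trans ler01) // gerBl.
have -> : s * envelope s * (2 * K) = 2 * s * (K * envelope s) by ring.
by rewrite ler_wpM2l // mulr_ge0 // ltW.
Qed.
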